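(* Assume preference data generated from a prompt distribution $\mathcal D_x$, a reference policy $\pi_{\rm ref}$ and a Bradley–Terry preference distribution $p^*$. The loss $\ell_{\rm TYPO}(\pi_\theta,\pi_{\rm ref},\lambda)=\ell_{\rm sup}(\pi_\theta)+\lambda\,\ell_{\rm unsup}(\pi_\theta,\pi_{\rm ref})$, $\lambda\in(0,\infty)$, with $$\ell_{\rm sup}(\pi_\theta)=\mathbb E_{x\sim\mathcal D_x,\{y_1,y_2\}\sim\pi_{\rm ref}(y|x)}\Big[\mathrm{KL}\big[p^*(z|y_1,y_2,x)\,\|\,p_\theta(z|y_1,y_2,x)\big]\Big],\qquad \ell_{\rm unsup}(\pi_\theta,\pi_{\rm ref})=\mathbb E_{x\sim\mathcal D_x}\big[\mathrm{KL}[\pi_{\rm ref}(y|x)\,\|\,\pi_\theta(y|x)]\big],$$ satisfies the strong interpolation criteria (SIC).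
   Context: A policy $\pi(y|x)$ is a conditional probability distribution over responses $y$ given a prompt $x$; prompts and responses come from finite sample spaces, and the responses considered are those with $\pi_{\rm ref}(y|x)>0$. Minimization over $\pi_\theta$ is over all policies. For a response pair $(y_1,y_2)$ the binary variable $z$ indicates $y_1\succ y_2$ ($z=1$) or $y_2\succ y_1$ ($z=0$), with $p^*(z=1|y_1,y_2,x)=p^*(y_1\succ y_2|x)$. Responses $y_1,y_2$ are drawn independently from $\pi_{\rm ref}(\cdot|x)$ (the case $y_1=y_2$ is either excluded or assigned preference $1/2$, which only adds constants). Also $p_\theta(z=1|y_1,y_2,x)=\frac{\pi_\theta(y_1|x)}{\pi_\theta(y_1|x)+\pi_\theta(y_2|x)}$ and $p_\theta(z=0|y_1,y_2,x)=\frac{\pi_\theta(y_2|x)}{\pi_\theta(y_1|x)+\pi_\theta(y_2|x)}$. Up to constants independent of $\pi_\theta$, $\ell_{\rm sup}(\pi_\theta)$ equals $\mathbb E_{\{y_w,y_l,x\}}\big[\log\big(1+\tfrac{\pi_\theta(y_l|x)}{\pi_\theta(y_w|x)}\big)\big]$, where $(y_w,y_l)=(y_1,y_2)$ if the label $z\sim p^*(z|y_1,y_2,x)$ is $1$ and $(y_2,y_1)$ otherwise, and $\ell_{\rm unsup}$ equals $-\mathbb E_{x\sim\mathcal D_x,\,y\sim\pi_{\rm ref}(y|x)}[\log\pi_\theta(y|x)]$. Bradley–Terry (BT): $p^*(y_1\succ y_2|x)=\frac{\exp r^*(y_1,x)}{\exp r^*(y_1,x)+\exp r^*(y_2,x)}$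 for a latent reward $r^*$. BT-optimal policy: $\pi^*(y|x)=\exp[r^*(y,x)]/\sum_{y'}\exp[r^*(y',x)]$, so $p^*(y_1\succ y_2|x)=\frac{\pi^*(y_1|x)}{\pi^*(y_1|x)+\pi^*(y_2|x)}$. Strong interpolation criteria: let $\lambda$ range over an interval with endpoints $a<b$ (open if $a=0$ or $b=\infty$; here $a=0$, $b=\infty$). A loss $\ell(\pi_\theta,\pi_{\rm ref},\lambda)$ satisfies the SIC if (1) $\lim_{\lambda\to a}\arg\min_{\pi_\theta}\ell(\pi_\theta,\pi_{\rm ref},\lambda)=\pi^*$; (2) $\lim_{\lambda\to b}\arg\min_{\pi_\theta}\ell(\pi_\theta,\pi_{\rm ref},\lambda)=\pi_{\rm ref}$; (3) for all other $\lambda\in(a,b)$ the optimal policy interpolates between these two extremes (no further quantitative condition is specified). *)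

(* Defs.v *)
From HB Require Import structures.
From mathcomp Require Import all_boot all_order all_algebra.
From mathcomp Require Import all_classical all_reals all_analysis.

Set Implicit Arguments.
Unset Strict Implicit.
Unset Printing Implicit Defensive.

Import Order.TTheory GRing.Theory Num.Theory.
Import numFieldNormedType.Exports.

Local Open Scope classical_set_scope.
Local Open Scope ring_scope.

Record distr (R : realType) (T : finType) := Distr {
  pmf :> T -> R;
  pmf_ge0 : forall t, 0 <= pmf t;
  pmf_sum1 : \sum_t pmf t = 1
}.

(* [pi x y] is pi(y|x). *)
Definition policy (R : realType) (X Y : finType) := X -> distr R Y.

Section Losses.
Variables (R : realType) (X Y : finType).

Definition expectation_fin (T : finType) (mu : T -> R) (f : T -> \bar R) : \bar R :=
  (\sum_t (mu t)%:E * f t)%E.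

(* Extended-real valued, with 0 ln(0/q) = 0 and p ln(p/0) = +oo if p <> 0;
   the latter must be explicit because p / 0 = 0 in MathComp. *)
Definition KL (T : finType) (p q : T -> R) : \bar R :=
  (\sum_t (if (p t == 0)%R then 0
           else if (q t == 0)%R then +oo
           else (p t * ln (p t / q t))%:E))%E.

(* The label z is true when y1 is preferred to y2. If pi gives mass 0 to both
   responses then both values are 0, and any divergence to it is +oo. *)
Definition ptheta (pi : policy R X Y) (x : X) (y1 y2 : Y) (z : bool) : R :=
  (if z then pi x y1 else pi x y2) / (pi x y1 + pi x y2).

Definition ell_sup (D : distr R X) (pstar : X -> Y -> Y -> R)
    (pi piref : policy R X Y) : \bar R :=
  expectation_fin D (fun x =>
    expectation_fin (piref x) (fun y1 =>
      expectation_fin (piref x) (fun y2 =>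
        KL (bernoulli_pmf (pstar x y1 y2)) (ptheta pi x y1 y2)))).

Definition ell_unsup (D : distr R X) (pi piref : policy R X Y) : \bar R :=
  expectation_fin D (fun x => KL (piref x) (pi x)).

Definition ell_typo (D : distr R X) (pstar : X -> Y -> Y -> R)
    (pi piref : policy R X Y) (lambda : R) : \bar R :=
  (ell_sup D pstar pi piref + lambda%:E * ell_unsup D pi piref)%E.

Definition bradley_terry (r : Y -> X -> R) (pstar : X -> Y -> Y -> R) : Prop :=
  forall x y1 y2,
    pstar x y1 y2 = expR (r y1 x) / (expR (r y1 x) + expR (r y2 x)).

(* Only the responses y with piref(y|x) > 0 are considered, so the
   normalization runs over those and the other responses have mass 0. *)
Definition bt_pmf (r : Y -> X -> R) (piref : policy R X Y) (x : X) (y : Y) : R :=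
  if 0 < piref x y
  then expR (r y x) / \sum_(y' | 0 < piref x y') expR (r y' x)
  else 0.

Lemma bt_pmf_ge0 r piref x y : 0 <= bt_pmf r piref x y.
Proof.
rewrite /bt_pmf; case: ifP => // _.
by rewrite divr_ge0 ?expR_ge0// sumr_ge0// => y' _; exact: expR_ge0.
Qed.

Lemma bt_pmf_sum1 r piref x : \sum_y bt_pmf r piref x y = 1.
Proof.
rewrite /bt_pmf -big_mkcond/= -mulr_suml divff// gt_eqF//.
have [y0 y0_gt0] : exists y0, 0 < piref x y0.
  apply/existsP; apply: contraT; rewrite negb_exists => /forallP h.
  have := pmf_sum1 (piref x); rewrite big1 => [/esym/eqP|y _].
    by rewrite oner_eq0.
  by apply/eqP; rewrite eq_le pmf_ge0 andbT leNgt h.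
rewrite (bigD1 y0)//= ltr_pwDl ?expR_gt0// sumr_ge0//.
Qed.

Definition bt_policy (r : Y -> X -> R) (piref : policy R X Y) : policy R X Y :=
  fun x => Distr (bt_pmf_ge0 r piref x) (bt_pmf_sum1 r piref x).

End Losses.

Section StrongInterpolation.
Variables (R : realType) (X Y : finType).

Definition is_argmin (L : policy R X Y -> \bar R) (pi : policy R X Y) : Prop :=
  forall pi', (L pi <= L pi')%E.

Definition is_selection (L : policy R X Y -> R -> \bar R)
    (sel : R -> policy R X Y) : Prop :=
  forall lambda : R, 0 < lambda -> is_argmin (L ^~ lambda) (sel lambda).

(* Strong interpolation criteria for [loss pi piref lambda] on the interval
   ]0, +oo[. The argmin is required to be a well-defined policy at every prompt
   of positive probability, the only prompts that an expectation over D can see;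
   a limit of argmins is the pointwise limit of [sel lambda], where [sel] is any
   choice of minimizers. Interpolation means that the optimal policy moves
   continuously with lambda and coincides with neither extreme, unless the two
   extremes coincide. *)
Record SIC (D : distr R X) (pistar piref : policy R X Y)
    (loss : policy R X Y -> policy R X Y -> R -> \bar R) : Prop := {
  sic_argmin_exists : forall lambda : R, 0 < lambda ->
    exists pi : policy R X Y, is_argmin (fun p => loss p piref lambda) pi;
  sic_argmin_unique : forall (lambda : R) (pi1 pi2 : policy R X Y), 0 < lambda ->
    is_argmin (fun p => loss p piref lambda) pi1 ->
    is_argmin (fun p => loss p piref lambda) pi2 ->
    forall x, 0 < D x -> pi1 x =1 pi2 x;
  sic_left : forall sel : R -> policy R X Y,
    is_selection (loss ^~ piref) sel ->
    forall x y, 0 < D x ->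
      sel lambda x y @[lambda --> 0^'+] --> pistar x y;
  sic_right : forall sel : R -> policy R X Y,
    is_selection (loss ^~ piref) sel ->
    forall x y, 0 < D x ->
      sel lambda x y @[lambda --> +oo] --> piref x y;
  sic_continuous : forall sel : R -> policy R X Y,
    is_selection (loss ^~ piref) sel ->
    forall x y, 0 < D x -> forall lambda0 : R, 0 < lambda0 ->
      sel lambda x y @[lambda --> lambda0] --> sel lambda0 x y;
  sic_between : forall (lambda : R) (pi : policy R X Y), 0 < lambda ->
    is_argmin (fun p => loss p piref lambda) pi ->
    forall x, 0 < D x -> ~ (pistar x =1 piref x) ->
      ~ (pi x =1 pistar x) /\ ~ (pi x =1 piref x)
}.

End StrongInterpolation.

(* Main.v *)
(** Writing [q = exp u], the risk at a single prompt is, up to a constant, a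
    sum of softplus terms minus a linear form in [u]; its minimizers over the
    simplex satisfy, for every response [y] and with [m = piref(.|x)],
      [lambda (q y - m y)
         + 2 m y \sum_z m z (q y / (q y + q z) - pstar y z) = 0].
    The left-hand side obeys a maximum principle: for two distributions [a] and
    [b], at a point where [a / b] is maximal all terms of the difference of the
    two left-hand sides are nonnegative. Hence [|a - b|] is at most a constant
    depending on [b] times that difference. Comparing two minimizers gives
    uniqueness and continuity in [lambda]; comparing a minimizer with the
    Bradley-Terry policy, which solves the equation for [lambda = 0], gives the
    limit at [0]. The limit at infinity is read off the equation itself. *)
Require Import Defs.
From HB Require Import structures.
From mathcomp Require Import all_boot all_order all_algebra.
From mathcomp Require Import all_classical all_reals all_analysis.
From mathcomp Require Import ring lra.

Set Implicit Arguments.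
Unset Strict Implicit.
Unset Printing Implicit Defensive.

Import Order.TTheory GRing.Theory Num.Theory.
Import numFieldNormedType.Exports.

Local Open Scope classical_set_scope.
Local Open Scope ring_scope.

(** * Finite and infinite values of divergences and expectations *)

Section ExtendedRealLosses.
Context {R : realType}.

Lemma KL_fin (T : finType) (p q : T -> R) :
  (forall t, p t != 0 -> q t != 0) ->
  KL p q = (\sum_t p t * ln (p t / q t))%:E.
Proof.
move=> pq; rewrite /KL -sumEFin; apply: eq_bigr => t _.
case: eqP => [->|/eqP p0]; first by rewrite mul0r.
by rewrite (negbTE (pq _ p0)).
Qed.

Lemma KL_neqNy (T : finType) (p q : T -> R) : KL p q != -oo%E.
Proof.
rewrite /KL esum_eqNy; apply/existsPn => t /=.
by case: (p t == 0) => //; case: (q t == 0).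
Qed.

Lemma KL_eqy (T : finType) (p q : T -> R) t :
  p t != 0 -> q t = 0 -> KL p q = +oo%E.
Proof.
move=> p0 q0; apply/eqP; rewrite /KL esum_eqy => [|i _].
  by apply/existsP; exists t; rewrite /= (negbTE p0) q0 eqxx.
by case: (p i == 0) => //; case: (q i == 0).
Qed.

Lemma expectation_fin_EFin (T : finType) (mu : T -> R) (f : T -> \bar R)
    (g : T -> R) :
  (forall t, mu t != 0 -> f t = (g t)%:E) ->
  expectation_fin mu f = (\sum_t mu t * g t)%:E.
Proof.
move=> fg; rewrite /expectation_fin -sumEFin; apply: eq_bigr => t _.
have [->|/fg ->] := eqVneq (mu t) 0; first by rewrite mul0e mul0r.
by rewrite EFinM.
Qed.

Lemma mule_ge0_neqNy (a : R) (e : \bar R) :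
  0 <= a -> e != -oo%E -> (a%:E * e)%E != -oo%E.
Proof.
rewrite le_eqVlt => /predU1P[<-|a0]; first by rewrite mul0e.
by case: e => // _; rewrite gt0_muley ?lte_fin.
Qed.

Lemma expectation_fin_neqNy (T : finType) (mu : T -> R) (f : T -> \bar R) :
  (forall t, 0 <= mu t) -> (forall t, f t != -oo%E) ->
  expectation_fin mu f != -oo%E.
Proof.
move=> mu0 f0; rewrite /expectation_fin esum_eqNy; apply/existsPn => t /=.
exact: mule_ge0_neqNy.
Qed.

Lemma expectation_fin_eqy (T : finType) (mu : T -> R) (f : T -> \bar R) t :
  (forall t, 0 <= mu t) -> (forall t, f t != -oo%E) ->
  mu t != 0 -> f t = +oo%E -> expectation_fin mu f = +oo%E.
Proof.
move=> mu0 f0 mut ft; apply/eqP; rewrite /expectation_fin esum_eqy => [|i _].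
  apply/existsP; exists t; rewrite /= ft gt0_muley// lte_fin.
  by rewrite lt_def mut mu0.
exact: mule_ge0_neqNy.
Qed.

End ExtendedRealLosses.

(** * The real-valued risk at a single prompt *)

Section PromptRisk.
Context {R : realType} {Y : finType}.
Implicit Types (m q : distr R Y) (p : Y -> Y -> R).

(** Absolute continuity of [m] with respect to [q]: for [lambda > 0], the condition under which the
    loss at a prompt is finite. *)
Definition covers m q := forall y, m y != 0 -> q y != 0.

Definition share (q : Y -> R) (y z : Y) : R := q y / (q y + q z).

Definition pair_mean m (f : Y -> Y -> R) : R :=
  \sum_y m y * \sum_z m z * f y z.

Definition prompt_risk (lambda : R) m p q : R :=
  pair_mean m (fun y z => p y z * ln (p y z / share q y z)
    + (1 - p y z) * ln ((1 - p y z) / share q z y))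
  + lambda * \sum_y m y * ln (m y / q y).

(** Competitors are restricted to covering distributions: elsewhere the true loss is infinite, while
    [prompt_risk] takes a finite value through division by 0 and [ln 0 = 0]. *)
Definition prompt_argmin (lambda : R) m p q :=
  covers m q /\ forall q', covers m q' ->
    prompt_risk lambda m p q <= prompt_risk lambda m p q'.

Lemma pmf_gt0 q y : q y != 0 -> 0 < q y.
Proof. by move=> q0; rewrite lt_def q0 Defs.pmf_ge0. Qed.

Lemma pmf_le1 q y : q y <= 1.
Proof.
rewrite -(Defs.pmf_sum1 q) (bigD1 y)//= lerDl sumr_ge0// => z _; exact: Defs.pmf_ge0.
Qed.

End PromptRisk.

(** * Reduction of the minimization over policies to one prompt at a time *)

Section PromptwiseReduction.
Context {R : realType} {X Y : finType}.
Variables (D : distr R X) (pstar : X -> Y -> Y -> R) (piref : policy R X Y).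
Variable lambda : R.
Hypothesis lambda_gt0 : 0 < lambda.
Implicit Types pi : policy R X Y.

Lemma ell_typo_fin pi :
  (forall x, D x != 0 -> covers (piref x) (pi x)) ->
  ell_typo D pstar pi piref lambda =
  (\sum_x D x * prompt_risk lambda (piref x) (pstar x) (pi x))%:E.
Proof.
move=> cov; rewrite /ell_typo /ell_sup /ell_unsup.
rewrite (@expectation_fin_EFin _ _ _ _ (fun x =>
  pair_mean (piref x) (fun y z =>
    pstar x y z * ln (pstar x y z / share (pi x) y z)
    + (1 - pstar x y z) * ln ((1 - pstar x y z) / share (pi x) z y)))).
  rewrite (@expectation_fin_EFin _ _ _ _ (fun x =>
    \sum_y piref x y * ln (piref x y / pi x y))); last first.
    by move=> x Dx; rewrite KL_fin//; exact: cov.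
  rewrite -EFinM -EFinD; congr (_%:E).
  rewrite mulr_sumr -big_split/=; apply: eq_bigr => x _.
  by rewrite /prompt_risk; ring.
move=> x Dx; apply: expectation_fin_EFin => y my.
apply: expectation_fin_EFin => z mz.
have qy := pmf_gt0 (cov _ Dx _ my); have qz := pmf_gt0 (cov _ Dx _ mz).
rewrite KL_fin; last first.
  by move=> b _; rewrite gt_eqF// divr_gt0 ?addr_gt0//; case: b.
by rewrite big_bool/= /ptheta /share [pi x z + _]addrC.
Qed.

(** The unsupervised term is already infinite and has a positive weight; the supervised term is
    never [-oo], so nothing cancels. *)
Lemma ell_typo_eqy pi x :
  D x != 0 -> ~ covers (piref x) (pi x) ->
  ell_typo D pstar pi piref lambda = +oo%E.
Proof.
move=> Dx /existsNP[y /not_implyP[my /negP/negPn/eqP qy]].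
rewrite /ell_typo.
have -> : ell_unsup D pi piref = +oo%E.
  apply: (@expectation_fin_eqy _ _ _ _ x) => //.
  - exact: Defs.pmf_ge0.
  - by move=> t; exact: KL_neqNy.
  - exact: KL_eqy my qy.
rewrite gt0_muley ?lte_fin// addey//.
apply: expectation_fin_neqNy => [|x']; first exact: Defs.pmf_ge0.
apply: expectation_fin_neqNy => [|y1]; first exact: Defs.pmf_ge0.
apply: expectation_fin_neqNy => [|y2]; first exact: Defs.pmf_ge0.
exact: KL_neqNy.
Qed.

(** The loss averages the prompt risks over [D], and a policy can be altered at one prompt without
    touching the others. *)
Lemma is_argminP pi :
  is_argmin (fun pi => ell_typo D pstar pi piref lambda) pi <->
  forall x, D x != 0 ->
    prompt_argmin lambda (piref x) (pstar x) (pi x).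
Proof.
split=> [amin|amin pi'].
  have cov x : D x != 0 -> covers (piref x) (pi x).
    (* [piref] covers itself, so its loss is finite and the minimum cannot be infinite. *)
    move=> Dx; apply: contrapT => ncov; have := amin piref.
    by rewrite (ell_typo_eqy Dx ncov) ell_typo_fin // => x' _ y.
  move=> x Dx; split; first exact: cov.
  move=> q covq.
  pose pi' : policy R X Y := fun x' => if x' == x then q else pi x'.
  have cov' x' : D x' != 0 -> covers (piref x') (pi' x').
    by rewrite /pi'; case: (x' =P x) => [->//|_]; exact: cov.
  have := amin pi'; rewrite !ell_typo_fin// lee_fin.
  rewrite (bigD1 x)//= [leRHS](bigD1 x)//= /pi' eqxx.
  rewrite [X in _ <= _ + X](eq_bigr (fun i => D i *
    prompt_risk lambda (piref i) (pstar i) (pi i))); last first.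
    by move=> i /negbTE ->.
  by rewrite lerD2r ler_pM2l// pmf_gt0.
have [cov'|/existsNP[x /not_implyP[Dx ncov]]] :=
    pselect (forall x, D x != 0 -> covers (piref x) (pi' x)); last first.
  by rewrite (ell_typo_eqy Dx ncov) leey.
rewrite !ell_typo_fin// => [|x Dx]; last exact: (amin x Dx).1.
rewrite lee_fin; apply: ler_sum => x _.
have [->|Dx] := eqVneq (D x) 0; first by rewrite !mul0r.
by rewrite ler_wpM2l ?Defs.pmf_ge0//; apply: (amin x Dx).2; exact: cov'.
Qed.

End PromptwiseReduction.

(** * The maximum principle for the score *)

Section Stability.
Context {R : realType} {Y : finType}.
Implicit Types (m q a b : distr R Y) (p : Y -> Y -> R).

(* Derivative of [prompt_risk] with respect to [ln (q y)] along the simplex. *)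
Definition score (lambda : R) m p q y : R :=
  lambda * (q y - m y) + 2 * m y * \sum_z m z * (share q y z - p y z).

Definition same_support m q := forall y, (q y == 0) = (m y == 0).

(** The sum over all pairs dominates the term at whichever pair realizes the extrema of [a / b].
    Pairs leaving the support contribute 0, by division by 0. *)
Definition stab_const m b : R :=
  \sum_y \sum_z 2 / (m y * m z * b y * b z).

Lemma distr_exists_neq0 q : exists y, q y != 0.
Proof.
apply/existsP; apply: contraT; rewrite negb_exists => /forallP q0.
have := Defs.pmf_sum1 q; rewrite big1 => [/esym/eqP|y _].
  by rewrite oner_eq0.
exact/eqP/negPn.
Qed.

(** Summing [a y <= c * b y] compares two total masses equal to 1. *)
Lemma ratio_le_total (P : pred Y) a b (c : R) :
  (forall y, ~~ P y -> a y = 0 /\ b y = 0) ->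
  (forall y, P y -> 0 < b y) ->
  (forall y, P y -> a y / b y <= c) -> 1 <= c.
Proof.
move=> offP b0 ac.
rewrite -(Defs.pmf_sum1 a) -[leRHS]mulr1 -(Defs.pmf_sum1 b) mulr_sumr.
apply: ler_sum => y _; have [Py|/offP[-> ->]] := boolP (P y); last by rewrite mulr0.
by rewrite -ler_pdivrMr ?ac ?b0.
Qed.

Lemma ratio_ge_total (P : pred Y) a b (c : R) :
  (forall y, ~~ P y -> a y = 0 /\ b y = 0) ->
  (forall y, P y -> 0 < b y) ->
  (forall y, P y -> c <= a y / b y) -> c <= 1.
Proof.
move=> offP b0 ac.
rewrite -[leRHS](Defs.pmf_sum1 a) -[leLHS]mulr1 -(Defs.pmf_sum1 b) mulr_sumr.
apply: ler_sum => y _; have [Py|/offP[-> ->]] := boolP (P y); last by rewrite mulr0.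
by rewrite -ler_pdivlMr ?ac ?b0.
Qed.

Lemma share_subr a b y z : 0 < a y -> 0 < a z -> 0 < b y -> 0 < b z ->
  share a y z - share b y z =
  (a y * b z - a z * b y) / ((a y + a z) * (b y + b z)).
Proof.
move=> ay az by_ bz; rewrite /share; field.
by rewrite !gt_eqF// addr_gt0.
Qed.

(* Maximum principle: where the ratio a / b is maximal, every term of the
   difference of the two scores is nonnegative, so the term pairing that point
   with the minimum of a / b is bounded by the whole difference. *)
Lemma score_stability m p a b (lambda eps : R) :
  0 <= lambda -> same_support m a -> same_support m b ->
  (forall y, `|score lambda m p a y - score lambda m p b y| <= eps) ->
  forall y, `|a y - b y| <= stab_const m b * eps.
Proof.
move=> l0 sa sb close.
have [y0 my0] := distr_exists_neq0 m.
have a_gt0 y : m y != 0 -> 0 < a y by rewrite -sa => /pmf_gt0.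
have b_gt0 y : m y != 0 -> 0 < b y by rewrite -sb => /pmf_gt0.
have off y : ~~ (m y != 0) -> a y = 0 /\ b y = 0.
  by rewrite negbK => my; split; apply/eqP; rewrite ?sa ?sb.
pose rho y := a y / b y.
have [y1 my1 max1] := @arg_maxP _ _ _ y0 (fun y => m y != 0) rho my0.
have [y2 my2 min2] := @arg_minP _ _ _ y0 (fun y => m y != 0) rho my0.
have rho1 : 1 <= rho y1 by apply: ratio_le_total max1.
have rho2 : rho y2 <= 1 by apply: ratio_ge_total min2.
have eps0 : 0 <= eps := le_trans (normr_ge0 _) (close y0).
have cross y : m y != 0 -> 0 <= a y1 * b y - a y * b y1.
  move=> my; rewrite subr_ge0 -ler_pdivlMr ?b_gt0// mulrAC.
  by rewrite -ler_pdivrMr ?b_gt0//; exact: max1.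
have term_ge0 y : 0 <= m y * (share a y1 y - share b y1 y).
  have [->|my] := eqVneq (m y) 0; first by rewrite mul0r.
  rewrite mulr_ge0 ?Defs.pmf_ge0// share_subr ?a_gt0 ?b_gt0//.
  by rewrite divr_ge0 ?cross// mulr_ge0// addr_ge0// Defs.pmf_ge0.
have gap : m y1 * m y2 * (a y1 * b y2 - a y2 * b y1) <= 2 * eps.
  have : 2 * m y1 * (m y2 * (share a y1 y2 - share b y1 y2)) <= eps.
    apply: le_trans (le_trans (ler_norm _) (close y1)).
    have -> : score lambda m p a y1 - score lambda m p b y1 =
        lambda * (a y1 - b y1) +
        2 * m y1 * \sum_z m z * (share a y1 z - share b y1 z).
      rewrite /score (_ : \sum_z m z * (share a y1 z - share b y1 z) =
        \sum_z m z * (share a y1 z - p y1 z) -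
        \sum_z m z * (share b y1 z - p y1 z)); first by ring.
      by rewrite -sumrB; apply: eq_bigr => z _; ring.
    rewrite ler_wpDl//.
      by rewrite mulr_ge0// subr_ge0 -[leLHS]mul1r -ler_pdivlMr ?b_gt0.
    rewrite ler_wpM2l ?mulr_ge0 ?Defs.pmf_ge0//.
    by rewrite (bigD1 y2)//= lerDl sumr_ge0.
  rewrite share_subr ?a_gt0 ?b_gt0// => le_eps.
  (* Masses are at most 1, so the denominator given by [share_subr] is at most 2 * 2; with the
     factor 2 of the score this leaves the constant 2 of [gap]. *)
  have : (a y1 * b y2 - a y2 * b y1) / 4 <=
         (a y1 * b y2 - a y2 * b y1) / ((a y1 + a y2) * (b y1 + b y2)).
    rewrite ler_wpM2l ?cross// lef_pV2 ?posrE ?mulr_gt0 ?addr_gt0 ?a_gt0 ?b_gt0//.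
    have -> : 4 = 2 * 2 :> R by ring.
    by rewrite ler_pM ?addr_ge0 ?Defs.pmf_ge0//
      (_ : 2 = 1 + 1)// lerD ?pmf_le1.
  move=> /(ler_wpM2l (mulr_ge0 (Defs.pmf_ge0 m y1) (Defs.pmf_ge0 m y2))).
  by move: le_eps; lra.
have spread : rho y1 - rho y2 <= stab_const m b * eps.
  have -> : rho y1 - rho y2 =
      (m y1 * m y2 * (a y1 * b y2 - a y2 * b y1)) / (m y1 * m y2 * b y1 * b y2).
    by rewrite /rho; field; rewrite my1 my2 !gt_eqF ?b_gt0.
  have w0 y z : 0 <= 2 / (m y * m z * b y * b z).
    by rewrite divr_ge0// !mulr_ge0// Defs.pmf_ge0.
  apply: (@le_trans _ _ (2 / (m y1 * m y2 * b y1 * b y2) * eps)).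
    by rewrite [leRHS]mulrAC ler_wpM2r// invr_ge0 !mulr_ge0// Defs.pmf_ge0.
  rewrite ler_wpM2r// /stab_const (bigD1 y1)//= (bigD1 y2)//= -addrA lerDl.
  by rewrite addr_ge0// sumr_ge0// => y _; rewrite ?sumr_ge0.
move=> y; have [my|my] := eqVneq (m y) 0.
  have [|-> ->] := off y; first by rewrite my eqxx.
  by rewrite subrr normr0 (le_trans _ spread)// subr_ge0 (le_trans rho2).
(* Both 1 and [rho y] lie between [rho y2] and [rho y1], so their distance is at most the spread;
   moreover [b y <= 1]. *)
have -> : a y - b y = (rho y - 1) * b y.
  by rewrite /rho mulrBl mul1r mulfVK// gt_eqF ?b_gt0.
rewrite normrM (ger0_norm (Defs.pmf_ge0 _ _)) -[leRHS]mulr1 ler_pM ?pmf_le1//.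
  exact: Defs.pmf_ge0.
apply: le_trans spread; rewrite ler_norml.
have : rho y <= rho y1 := max1 y my.
have : rho y2 <= rho y := min2 y my.
by lra.
Qed.

End Stability.

(** * Means over pairs of independent responses *)

Section PairMean.
Context {R : realType} {Y : finType}.
Implicit Types (m : distr R Y) (f g : Y -> Y -> R).

Lemma eq_pair_mean m f g :
  (forall y z, m y != 0 -> m z != 0 -> f y z = g y z) ->
  pair_mean m f = pair_mean m g.
Proof.
move=> fg; apply: eq_bigr => y _.
have [->|my] := eqVneq (m y) 0; first by rewrite !mul0r.
congr (_ * _); apply: eq_bigr => z _.
by have [->|mz] := eqVneq (m z) 0; rewrite ?mul0r// fg.
Qed.

Lemma pair_mean_le m f g :
  (forall y z, m y != 0 -> m z != 0 -> f y z <= g y z) ->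
  pair_mean m f <= pair_mean m g.
Proof.
move=> fg; apply: ler_sum => y _.
have [->|my] := eqVneq (m y) 0; first by rewrite !mul0r.
rewrite ler_wpM2l ?Defs.pmf_ge0//; apply: ler_sum => z _.
have [->|mz] := eqVneq (m z) 0; first by rewrite !mul0r.
by rewrite ler_wpM2l ?Defs.pmf_ge0// fg.
Qed.

Lemma pair_meanD m f g :
  pair_mean m (fun y z => f y z + g y z) = pair_mean m f + pair_mean m g.
Proof.
rewrite /pair_mean -big_split/=; apply: eq_bigr => y _.
rewrite -mulrDr -big_split/=; congr (_ * _).
by apply: eq_bigr => z _; rewrite mulrDr.
Qed.

Lemma pair_meanZ m f (c : R) :
  pair_mean m (fun y z => c * f y z) = c * pair_mean m f.
Proof.
rewrite /pair_mean mulr_sumr; apply: eq_bigr => y _.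
rewrite mulrCA; congr (_ * _); rewrite mulr_sumr.
by apply: eq_bigr => z _; rewrite mulrCA.
Qed.

Lemma pair_mean_ge0 m f :
  (forall y z, m y != 0 -> m z != 0 -> 0 <= f y z) -> 0 <= pair_mean m f.
Proof.
move=> f0; rewrite -(mul0r (pair_mean m f)) -pair_meanZ.
by apply: pair_mean_le => y z my mz; rewrite mul0r f0.
Qed.

Lemma pair_mean_swap m f : pair_mean m (fun y z => f z y) = pair_mean m f.
Proof.
rewrite /pair_mean; under eq_bigr do rewrite mulr_sumr.
rewrite exchange_big/=; apply: eq_bigr => y _; rewrite mulr_sumr.
by apply: eq_bigr => z _; rewrite mulrCA.
Qed.

Lemma pair_mean_pick m f y0 :
  pair_mean m (fun y z => (y == y0)%:R * f y z) = m y0 * \sum_z m z * f y0 z.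
Proof.
rewrite /pair_mean (bigD1 y0)//= eqxx [X in _ + X]big1 ?addr0.
  by congr (_ * _); apply: eq_bigr => z _; rewrite mul1r.
move=> y /negbTE ->; rewrite big1 ?mulr0// => z _.
by rewrite mul0r mulr0.
Qed.

End PairMean.

(** * The prompt risk in log-coordinates *)

Section Potential.
Context {R : realType} {Y : finType}.
Implicit Types (m q : distr R Y) (u v : Y -> R).

Definition softplus (t : R) : R := ln (1 + expR t).

Lemma softplusN t : softplus (- t) = softplus t - t.
Proof.
have e0 := expR_gt0 t.
rewrite /softplus -[X in _ = _ - X](expRK t) -ln_div ?posrE ?addr_gt0//.
by congr ln; rewrite expRN; field; rewrite gt_eqF.
Qed.

Lemma softplus_ge0 t : 0 <= softplus t.
Proof. by rewrite ln_ge0// lerDl expR_ge0. Qed.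

Lemma softplus_ge_id t : t <= softplus t.
Proof. by have := softplus_ge0 (- t); rewrite softplusN subr_ge0. Qed.

(** This is [ln (1 + x) <= x] applied to the quotient of the two arguments of [ln]. It is exact to
    first order at [s = 0], so the first-order condition can be read off the majorant. *)
Lemma softplusD_le (d s : R) :
  softplus (d + s) <= softplus d + (expR s - 1) * (expR d / (1 + expR d)).
Proof.
have e0 := expR_gt0 d; have es := expR_gt0 s.
have d1 : 0 < 1 + expR d by rewrite addr_gt0.
rewrite -lerBlDl /softplus expRD -ln_div ?posrE ?addr_gt0 ?mulr_gt0//.
have -> : (1 + expR d * expR s) / (1 + expR d) =
    1 + (expR s - 1) * (expR d / (1 + expR d)).
  by field; rewrite gt_eqF.
apply: le_ln1Dx; rewrite mulrA ltr_pdivlMr//.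
by rewrite mulrBl mul1r mulN1r -subr_gt0 (_ : _ - _ = 1 + expR s * expR d);
  [rewrite addr_gt0// mulr_gt0 | ring].
Qed.

Lemma logistic_share q y z : 0 < q y -> 0 < q z ->
  expR (ln (q y) - ln (q z)) / (1 + expR (ln (q y) - ln (q z))) = share q y z.
Proof.
move=> qy qz; rewrite expRB !lnK ?posrE// /share; field.
by rewrite !gt_eqF// addr_gt0.
Qed.

Lemma ln_share q y z : 0 < q y -> 0 < q z ->
  ln (share q z y) = - softplus (ln (q y) - ln (q z)).
Proof.
move=> qy qz; rewrite /softplus expRB !lnK ?posrE// -lnV; last first.
  by rewrite posrE addr_gt0// divr_gt0.
by congr ln; rewrite /share; field; rewrite !gt_eqF// addr_gt0.
Qed.

Variables (m : distr R Y) (p : Y -> Y -> R) (lambda : R).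
Hypothesis p01 : forall y z, 0 < p y z < 1.

(* [prompt_risk] in the log-coordinates [u y = ln (q y)], up to a constant. *)
Definition potential u : R :=
  pair_mean m (fun y z => softplus (u y - u z) - p y z * (u y - u z))
  - lambda * \sum_y m y * u y.

(** The constant collects the entropy terms of [p] and [m]. It is chosen before [q], so risks are
    compared through their potentials. *)
Lemma prompt_risk_potential : exists C : R, forall q, covers m q ->
  prompt_risk lambda m p q = C + potential (fun y => ln (q y)).
Proof.
exists (pair_mean m (fun y z =>
    p y z * ln (p y z) + (1 - p y z) * ln (1 - p y z))
  + lambda * \sum_y m y * ln (m y)) => q cov.
rewrite /prompt_risk /potential.
rewrite [X in _ + _ * X = _](_ : _ =
    \sum_y m y * ln (m y) - \sum_y m y * ln (q y)); last first.
  rewrite -sumrB; apply: eq_bigr => y _.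
  have [->|my] := eqVneq (m y) 0; first by rewrite !mul0r subrr.
  by rewrite ln_div ?posrE ?pmf_gt0 ?cov// mulrBr.
rewrite mulrBr addrACA -pair_meanD; congr (_ + _).
apply: eq_pair_mean => y z my mz.
have qy := pmf_gt0 (cov _ my); have qz := pmf_gt0 (cov _ mz).
have /andP[p0 p1] := p01 y z.
have share_gt0 (a b : Y) : 0 < q a -> 0 < q b -> 0 < share q a b.
  by move=> qa qb; rewrite divr_gt0// addr_gt0.
rewrite [ln (p y z / _)]ln_div ?posrE ?share_gt0//.
rewrite [ln (_ / share _ _ _)]ln_div ?posrE ?share_gt0 ?subr_gt0//.
by rewrite !ln_share// -[ln (q z) - _]opprB softplusN; ring.
Qed.

Lemma eq_potential u v :
  (forall y, m y != 0 -> u y = v y) -> potential u = potential v.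
Proof.
move=> uv; rewrite /potential; congr (_ - _ * _).
  by apply: eq_pair_mean => y z my mz; rewrite !uv.
apply: eq_bigr => y _.
by have [->|my] := eqVneq (m y) 0; rewrite ?mul0r// uv.
Qed.

(** The pair terms see only differences of [u], and [m] has total mass 1. *)
Lemma potential_shift u (c : R) :
  potential (fun y => u y - c) = potential u + lambda * c.
Proof.
rewrite /potential.
have -> : \sum_y m y * (u y - c) = \sum_y m y * u y - c.
  rewrite -[X in _ - X]mul1r -(Defs.pmf_sum1 m) mulr_suml -sumrB.
  by apply: eq_bigr => y _; rewrite mulrBr.
rewrite (@eq_pair_mean _ _ _ _
  (fun y z => softplus (u y - u z) - p y z * (u y - u z))); first by ring.
by move=> y z _ _; have -> : u y - c - (u z - c) = u y - u z by ring.
Qed.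

End Potential.

(** * The first-order condition for minimizers *)

Section Minimizers.
Context {R : realType} {Y : finType}.
Implicit Types q : distr R Y.

Lemma normalized_ge0 (w : Y -> R) :
  (forall y, 0 <= w y) -> forall y, 0 <= w y / \sum_z w z.
Proof. by move=> w0 y; rewrite divr_ge0// sumr_ge0. Qed.

Lemma normalized_sum1 (w : Y -> R) :
  0 < \sum_z w z -> \sum_y w y / \sum_z w z = 1.
Proof. by move=> W0; rewrite -mulr_suml divff// gt_eqF. Qed.

Definition normalized (w : Y -> R) (w0 : forall y, 0 <= w y)
    (W0 : 0 < \sum_z w z) : distr R Y :=
  Distr (normalized_ge0 w0) (normalized_sum1 W0).

(** The function of [t] vanishes at 0, hence is minimal there, and its derivative at that point is
    zero. *)
Lemma critical_at0 (a b c : R) :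
  (forall t, 0 <= a * (expR t - 1) + b * (expR (- t) - 1) + c * t) ->
  a - b + c = 0.
Proof.
move=> f_ge0.
pose f t : R := a * (expR t - 1) + b * (expR (- t) - 1) + c * t.
have df (t : R) : is_derive t 1 f (a * expR t - b * expR (- t) + c).
  apply: is_derive_eq; rewrite /GRing.scale/=; ring.
have f0 : f 0 = 0 by rewrite /f oppr0 expR0 !subrr !mulr0 !addr0.
have [] := @derive1_at_min _ f (-1) 1 0.
- lra.
- by move=> t _; have [] := df t.
- by rewrite in_itv/= ltrN10 ltr01.
- by move=> t _; rewrite f0; exact: f_ge0.
move=> _; have [_ ->] := df 0.
by rewrite oppr0 expR0 !mulr1.
Qed.

Variables (m : distr R Y) (p : Y -> Y -> R) (lambda : R).
Hypothesis p01 : forall y z, 0 < p y z < 1.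
Hypothesis pC : forall y z, p y z + p z y = 1.
Hypothesis lambda_gt0 : 0 < lambda.

(** Allows unnormalized competitors: dividing by the total mass shifts the log-weights, which costs
    the [lambda * ln] term. *)
Lemma argmin_potential_le q (w : Y -> R) :
  prompt_argmin lambda m p q ->
  (forall y, 0 <= w y) -> (forall y, m y != 0 -> 0 < w y) ->
  potential m p lambda (fun y => ln (q y)) <=
  potential m p lambda (fun y => ln (w y)) + lambda * ln (\sum_y w y).
Proof.
move=> [covq minq] w0 wm.
have W0 : 0 < \sum_y w y.
  have [y my] := distr_exists_neq0 m.
  by rewrite (bigD1 y)//= ltr_pwDl ?wm// sumr_ge0.
pose q' := normalized w0 W0.
have q'm y : m y != 0 -> 0 < q' y by move=> my; rewrite divr_gt0 ?wm.
have covq' : covers m q' by move=> y my; rewrite gt_eqF ?q'm.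
have [C CE] := @prompt_risk_potential _ _ m p lambda p01.
have := minq _ covq'; rewrite !CE// lerD2l -potential_shift.
rewrite [leRHS](@eq_potential _ _ _ _ _ _
  (fun y => ln (w y) - ln (\sum_z w z)))// => y my.
by rewrite /= ln_div// posrE ?wm.
Qed.

(* Multiplying [q y0] by [expR t] and renormalizing gives, through
   [ln (1 + x) <= x], a majorant of the risk whose derivative at [t = 0]
   is the score. *)
Lemma argmin_score q : prompt_argmin lambda m p q ->
  forall y, score lambda m p q y = 0.
Proof.
move=> amin y0; have covq := amin.1.
have q_gt0 y : m y != 0 -> 0 < q y by move=> /covq/pmf_gt0.
pose d (y : Y) : R := (y == y0)%:R.
(* In a pair where only the first response is [y0] the log-ratio moves by [t], where only the second
   is [y0] it moves by [- t], and otherwise it is unchanged. [drift] collects the terms linear in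
   [t]. *)
pose up y z := d y * ((1 - d z) * share q y z).
pose down y z := d z * ((1 - d y) * share q y z).
pose drift y z := (d y - d z) * p y z.
have d01 y : d y = 0 \/ d y = 1 by rewrite /d; case: eqP; [right|left].
have sumd (f : Y -> R) : \sum_y f y * d y = f y0.
  rewrite (bigD1 y0)//= /d eqxx mulr1 big1 ?addr0// => y /negbTE ->.
  by rewrite mulr0.
have : pair_mean m up + lambda * q y0 - pair_mean m down +
    (- pair_mean m drift - lambda * m y0) = 0.
  apply: critical_at0 => t.
  pose w y := q y * expR (t * d y).
  have w0 y : 0 <= w y by rewrite mulr_ge0 ?Defs.pmf_ge0 ?expR_ge0.
  have wm y : m y != 0 -> 0 < w y by move=> my; rewrite mulr_gt0 ?expR_gt0 ?q_gt0.
  have WE : \sum_y w y = 1 + (expR t - 1) * q y0.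
    rewrite -(sumd (fun y => (expR t - 1) * q y)).
    rewrite -[X in _ = X + _](Defs.pmf_sum1 q) -big_split/=; apply: eq_bigr => y _; rewrite /w.
    by case: (d01 y) => ->; rewrite ?mulr0 ?mulr1 ?expR0; ring.
  have lnW : ln (\sum_y w y) <= (expR t - 1) * q y0.
    rewrite WE; apply: le_ln1Dx; rewrite -subr_gt0 opprK addrC -WE.
    have [y my] := distr_exists_neq0 m.
    by rewrite (bigD1 y)//= ltr_pwDl ?wm// sumr_ge0.
  have := argmin_potential_le amin w0 wm.
  rewrite [in leRHS](@eq_potential _ _ _ _ _ _ (fun y => ln (q y) + t * d y));
    last first.
    by move=> y my; rewrite lnM ?posrE ?expR_gt0 ?q_gt0// expRK.
  have step : potential m p lambda (fun y => ln (q y) + t * d y) <=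
      potential m p lambda (fun y => ln (q y)) +
      ((expR t - 1) * pair_mean m up + (expR (- t) - 1) * pair_mean m down
       - t * pair_mean m drift - lambda * (t * m y0)).
    rewrite /potential.
    have -> : \sum_y m y * (ln (q y) + t * d y) =
        \sum_y m y * ln (q y) + t * m y0.
      rewrite -(sumd (fun y => m y)) mulr_sumr -big_split/=.
      by apply: eq_bigr => y _; ring.
    set F := pair_mean m (fun y z => softplus (ln (q y) - ln (q z)) - _).
    set S := \sum_y _.
    suff : pair_mean m (fun y z => softplus (ln (q y) + t * d y - (ln (q z) + t * d z))
        - p y z * (ln (q y) + t * d y - (ln (q z) + t * d z))) <=
      F + ((expR t - 1) * pair_mean m up + (expR (- t) - 1) * pair_mean m down +
           (- t) * pair_mean m drift) by lra.
    rewrite /F -!pair_meanZ -!pair_meanD; apply: pair_mean_le => y z my mz.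
    have -> : ln (q y) + t * d y - (ln (q z) + t * d z) =
      (ln (q y) - ln (q z)) + t * (d y - d z) by ring.
    have := softplusD_le (ln (q y) - ln (q z)) (t * (d y - d z)).
    rewrite logistic_share ?q_gt0//.
    have -> : (expR (t * (d y - d z)) - 1) * share q y z =
       (expR t - 1) * up y z + (expR (- t) - 1) * down y z.
      rewrite /up /down; case: (d01 y) => ->; case: (d01 z) => ->;
        rewrite ?subrr ?mulr0 ?expR0 ?subr0 ?sub0r ?mulr1 ?mulrN1; ring.
    by rewrite /drift; lra.
  have := ler_wpM2l (ltW lambda_gt0) lnW.
  by move: step; lra.
rewrite /score.
have antisym : forall y z, m y != 0 -> m z != 0 ->
    share q z y - p z y = - (share q y z - p y z).
  move=> y z /q_gt0 qy /q_gt0 qz.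
  have -> : share q z y = 1 - share q y z.
    by rewrite /share; field; rewrite !gt_eqF// addr_gt0.
  by have := pC y z; lra.
suff : pair_mean m up - pair_mean m down - pair_mean m drift =
    2 * m y0 * \sum_z m z * (share q y0 z - p y0 z) by lra.
pose f y z := d y * (share q y z - p y z).
(* By antisymmetry the pairs with [y0] in second position contribute as much as those with [y0] in
   first position; this is the factor 2 of the score. *)
transitivity (pair_mean m f + pair_mean m (fun y z => f z y)).
  rewrite -2![- pair_mean m _]mulN1r -!pair_meanZ -!pair_meanD.
  apply: eq_pair_mean => y z my mz.
  by rewrite /f (antisym y z)// /up /down /drift; ring.
rewrite (pair_mean_swap m f).
have -> : pair_mean m f = m y0 * \sum_z m z * (share q y0 z - p y0 z).
  exact: (pair_mean_pick m (fun y z => share q y z - p y z)).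
by ring.
Qed.

End Minimizers.

(** * Existence of minimizers by compactness *)

Section Existence.
Context {R : realType} {Y : finType}.

Lemma continuous_sum (T : topologicalType) (P : pred Y) (f : Y -> T -> R) :
  (forall y, continuous (f y)) ->
  continuous (fun t => \sum_(y | P y) f y t).
Proof.
move=> cf; apply: continuous_big => [|y _]; last exact: cf.
exact: add_continuous.
Qed.

Lemma continuous_softplus : continuous (@softplus R).
Proof.
move=> t; apply: (@continuous_comp _ _ _ (fun t => 1 + expR t) (@ln R)).
  by apply: cvgD; [exact: cvg_cst | exact: continuous_expR].
by apply: continuous_ln; rewrite addr_gt0 ?expR_gt0.
Qed.

Variables (m : distr R Y) (p : Y -> Y -> R) (lambda : R).
Hypothesis p01 : forall y z, 0 < p y z < 1.
Hypothesis lambda_gt0 : 0 < lambda.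

Definition log_partition (u : Y -> R) : R :=
  ln (\sum_(y | m y != 0) expR (u y)).

Lemma partition_gt0 (u : Y -> R) : 0 < \sum_(y | m y != 0) expR (u y).
Proof.
have [y my] := distr_exists_neq0 m.
by rewrite (bigD1 y)//= ltr_pwDl ?expR_gt0// sumr_ge0// => z _; exact: expR_ge0.
Qed.

Lemma continuous_potential (T : topologicalType) (u : Y -> T -> R) :
  (forall y, continuous (u y)) ->
  continuous (fun t => potential m p lambda (u ^~ t)).
Proof.
move=> cu; have cd y z : continuous (fun t => u y t - u z t).
  by move=> t; apply: cvgB; exact: cu.
have cpair y z : continuous (fun t => m z *
    (softplus (u y t - u z t) - p y z * (u y t - u z t))).
  move=> t; apply: cvgMl_tmp; apply: cvgB; last by apply: cvgMl_tmp; exact: cd.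
  apply: (@continuous_comp _ _ _ (fun t => u y t - u z t) softplus).
    exact: cd.
  exact: continuous_softplus.
have crow y : continuous (fun t => m y * \sum_z m z *
    (softplus (u y t - u z t) - p y z * (u y t - u z t))).
  by move=> t; apply: cvgMl_tmp; apply: (@continuous_sum _ predT).
have clin : continuous (fun t => \sum_y m y * u y t).
  by apply: continuous_sum => y t; apply: cvgMl_tmp; exact: cu.
move=> t; rewrite /potential /pair_mean.
apply: (@cvgB _ _ _ _ _
  (fun t => \sum_y m y * \sum_z m z *
    (softplus (u y t - u z t) - p y z * (u y t - u z t)))
  (fun t => lambda * \sum_y m y * u y t)).
  exact: (@continuous_sum _ predT).
by apply: cvgMl_tmp; exact: clin.
Qed.

Lemma continuous_log_partition (T : topologicalType) (u : Y -> T -> R) :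
  (forall y, continuous (u y)) -> continuous (fun t => log_partition (u ^~ t)).
Proof.
move=> cu t; apply: (@continuous_comp _ _ _
  (fun t => \sum_(y | m y != 0) expR (u y t)) (@ln R)).
  apply: continuous_sum => y {}t.
  apply: (@continuous_comp _ _ _ (u y) expR); first exact: cu.
  exact: continuous_expR.
by apply: continuous_ln; exact: partition_gt0.
Qed.

Definition free_potential (u : Y -> R) : R :=
  potential m p lambda u + lambda * log_partition u.

Lemma continuous_free_potential (T : topologicalType) (u : Y -> T -> R) :
  (forall y, continuous (u y)) -> continuous (fun t => free_potential (u ^~ t)).
Proof.
move=> cu t; apply: (@cvgD _ _ _ _ _ (fun t => potential m p lambda (u ^~ t))
  (fun t => lambda * log_partition (u ^~ t))).
  exact: continuous_potential.
by apply: cvgMl_tmp; exact: continuous_log_partition.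
Qed.

(** Each pair term is [p * (softplus t - t) + (1 - p) * softplus t], hence nonnegative; in the
    linear part all summands have the same sign and only that of [y] is kept. This is the coercivity
    used outside the box. *)
Lemma potential_ge (u : Y -> R) y : (forall z, m z != 0 -> u z <= 0) ->
  lambda * (m y * - u y) <= potential m p lambda u.
Proof.
move=> u0; rewrite /potential -[leLHS]add0r; apply: lerD.
  apply: pair_mean_ge0 => x z _ _; have /andP[p0 p1] := p01 x z.
  set t := u x - u z.
  have := mulr_ge0 (ltW p0) (_ : 0 <= softplus t - t).
  rewrite subr_ge0 => /(_ (softplus_ge_id t)).
  have := mulr_ge0 (_ : 0 <= 1 - p x z) (softplus_ge0 t).
  by rewrite subr_ge0 => /(_ (ltW p1)); lra.
rewrite -mulrN -sumrN ler_wpM2l ?(ltW lambda_gt0)// (bigD1 y)//= mulrN lerDl.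
apply: sumr_ge0 => z _; rewrite oppr_ge0.
have [->|mz] := eqVneq (m z) 0; first by rewrite mul0r.
by rewrite mulr_ge0_le0 ?Defs.pmf_ge0// u0.
Qed.

(* The potential plus [lambda] times the log-partition function is invariant
   under shifts of [u], so it may be minimized over a box instead of the
   simplex; the box is large enough that [u = 0] beats everything outside. *)
Lemma prompt_argmin_exists : exists q, prompt_argmin lambda m p q.
Proof.
pose G : {ptws Y -> R} -> R := free_potential.
(* Chosen so that [lambda * m y * M] dominates the value at [u = 0] for every [y] in the support of
   [m]. *)
pose M := \sum_y `|G (fun=> 0)| / (lambda * m y).
have summand_ge0 y : 0 <= `|G (fun=> 0)| / (lambda * m y).
  by rewrite divr_ge0// mulr_ge0 ?Defs.pmf_ge0// ltW.
have M_ge0 : 0 <= M by exact: sumr_ge0.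
have M_large y : m y != 0 -> G (fun=> 0) <= lambda * (m y * M).
  move=> my; apply: le_trans (ler_norm _) _.
  rewrite mulrA mulrC -ler_pdivrMr ?mulr_gt0 ?pmf_gt0//.
  by rewrite /M (bigD1 y)//= lerDl sumr_ge0.
pose box : set {ptws Y -> R} := [set u | forall y, `[- M, 0]%classic (u y)].
have box0 : box (fun=> 0) by move=> y /=; rewrite in_itv/= oppr_le0 M_ge0 lexx.
have box_compact : compact box.
  apply: (@tychonoff Y (fun=> R) (fun=> `[- M, 0]%classic)) => y.
  exact: segment_compact.
have G_cont : continuous G.
  have coord (y : Y) : continuous (fun u : {ptws Y -> R} => u y).
    exact: (@proj_continuous Y (fun=> R) y).
  exact: (@continuous_free_potential _ (fun y (u : {ptws Y -> R}) => u y)).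
have box_nonempty : box !=set0 by exists (fun=> 0).
have [u _ u_min] := compact_EVT_min box_nonempty box_compact
  (continuous_subspaceT G_cont).
pose w y := if m y != 0 then expR (u y) else 0.
have w0 y : 0 <= w y by rewrite /w; case: ifP => // _; exact: expR_ge0.
have W0 : 0 < \sum_y w y by rewrite /w -big_mkcond; exact: partition_gt0.
pose q := normalized w0 W0.
have wm y : m y != 0 -> w y = expR (u y) by move=> my; rewrite /w my.
have covq : covers m q.
  by move=> y my; rewrite gt_eqF// divr_gt0// wm// expR_gt0.
have [C CE] := @prompt_risk_potential _ _ m p lambda p01.
exists q; split=> // q' covq'; rewrite !CE// lerD2l.
have -> : potential m p lambda (fun y => ln (q y)) = G u.
  rewrite /G /free_potential /log_partition -potential_shift; apply: eq_potential => y my.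
  rewrite /= wm// ln_div ?posrE ?expR_gt0// expRK.
  by rewrite /w -big_mkcond.
(* The coordinates off the support do not affect the potential; the value 0 keeps them in the
   box. *)
pose v y := if m y != 0 then ln (q' y) else 0.
have vm y : m y != 0 -> v y = ln (q' y) by move=> my; rewrite /v my.
rewrite -(@eq_potential _ _ m p lambda v)//.
have v_le0 y : v y <= 0.
  by rewrite /v; case: ifP => // my; rewrite ln_le0// pmf_le1.
have [v_box|/existsNP[y /negP]] := pselect (forall y, - M <= v y); last first.
  rewrite -ltNge => vy.
  have my : m y != 0.
    by apply: contraTneq vy => my; rewrite /v my eqxx/= -leNgt oppr_le0.
  apply: le_trans (potential_ge y (fun z _ => v_le0 z)).
  apply: le_trans (u_min _ (mem_set box0)) _.
  apply: le_trans (M_large _ my) _.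
  by rewrite !ler_wpM2l ?Defs.pmf_ge0 ?(ltW lambda_gt0)// lerNr ltW.
apply: le_trans (u_min v _) _.
  by apply: mem_set => y /=; rewrite in_itv/= v_box v_le0.
(* The partition function of [v] is the mass that [q'] gives to the support of [m], at most 1, so
   its logarithm is nonpositive. *)
rewrite /G /free_potential gerDl; apply: mulr_ge0_le0; first exact: ltW.
rewrite /log_partition ln_le0//.
rewrite (eq_bigr (fun y => q' y)); last first.
  by move=> y my; rewrite vm// lnK// posrE pmf_gt0// covq'.
rewrite -(Defs.pmf_sum1 q') [leRHS](bigID (fun y => m y != 0))/= lerDl.
by rewrite sumr_ge0// => y _; exact: Defs.pmf_ge0.
Qed.

End Existence.

(** * Quantitative estimates for the minimizers at one prompt *)

Section PromptLimits.
Context {R : realType} {Y : finType}.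
Implicit Types (m a b q : distr R Y).

(** The score is affine in the parameter with slope [q y - m y], of size at most 1; this lets scores
    at different parameters be compared. *)
Lemma score_shift m (p : Y -> Y -> R) q (lambda mu : R) y :
  score mu m p q y = score lambda m p q y + (mu - lambda) * (q y - m y).
Proof. by rewrite /score; ring. Qed.

Lemma share_bounds q y z : 0 <= share q y z <= 1.
Proof.
have y0 := Defs.pmf_ge0 q y; have z0 := Defs.pmf_ge0 q z.
rewrite /share divr_ge0 ?addr_ge0//=.
have [s0|s0] := eqVneq (q y + q z) 0; first by rewrite s0 invr0 mulr0.
by rewrite ler_pdivrMr ?mul1r ?lerDl// lt_def s0 addr_ge0.
Qed.

Lemma dist_pmf_le1 a b y : `|a y - b y| <= 1.
Proof.
rewrite ler_norml; have := Defs.pmf_ge0 a y; have := Defs.pmf_ge0 b y.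
by have := pmf_le1 a y; have := pmf_le1 b y; lra.
Qed.

Variables (m : distr R Y) (p : Y -> Y -> R).
Hypothesis p01 : forall y z, 0 < p y z < 1.
Hypothesis pC : forall y z, p y z + p z y = 1.

(** Where [m y = 0] the score reduces to [lambda * q y], which must vanish; the other inclusion is
    [covers]. *)
Lemma argmin_same_support (lambda : R) q : 0 < lambda ->
  prompt_argmin lambda m p q -> same_support m q.
Proof.
move=> l0 amin y; have [my|my] := eqVneq (m y) 0; last first.
  by apply/negbTE; exact: amin.1.
have := argmin_score p01 pC l0 amin y.
by rewrite /score my subr0 mulr0 mul0r addr0 => /eqP; rewrite mulf_eq0 gt_eqF.
Qed.

(* Compares the scores of the two minimizers at the common parameter [l0]. *)
Lemma argmin_lipschitz (l l0 : R) a b : 0 < l -> 0 < l0 ->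
  prompt_argmin l m p a -> prompt_argmin l0 m p b ->
  forall y, `|a y - b y| <= stab_const m b * `|l - l0|.
Proof.
move=> l_gt0 l0_gt0 amin bmin.
apply: (@score_stability _ _ m p a b l0); first exact: ltW.
- exact: argmin_same_support amin.
- exact: argmin_same_support bmin.
move=> y; rewrite (argmin_score p01 pC l0_gt0 bmin) subr0.
rewrite (score_shift m p a l) (argmin_score p01 pC l_gt0 amin) add0r.
by rewrite normrM distrC ler_piMr// dist_pmf_le1.
Qed.

(** In the score equation the preference term is at most 2 in absolute value, being [2 * m y] times
    a mean of differences of probabilities. *)
Lemma argmin_near_ref (l : R) q : 0 < l -> prompt_argmin l m p q ->
  forall y, `|q y - m y| <= 2 / l.
Proof.
move=> l0 amin y; have := argmin_score p01 pC l0 amin y; rewrite /score.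
set S := \sum_z _ => score0.
have S1 : `|S| <= 1.
  apply: le_trans (ler_norm_sum _ _ _) _; rewrite -(Defs.pmf_sum1 m).
  apply: ler_sum => z _; rewrite normrM ger0_norm ?Defs.pmf_ge0//.
  rewrite ler_piMr ?Defs.pmf_ge0// ler_norml.
  by have := p01 y z; have := share_bounds q y z; lra.
rewrite ler_pdivlMr// mulrC -[X in X * _](gtr0_norm l0) -normrM.
rewrite (_ : l * _ = - (2 * m y * S)); last by move: score0; lra.
rewrite normrN normrM ger0_norm ?mulr_ge0 ?Defs.pmf_ge0//.
rewrite -[leRHS]mulr1 ler_pM ?mulr_ge0 ?Defs.pmf_ge0//.
by rewrite -[leRHS]mulr1 ler_wpM2l// pmf_le1.
Qed.

(** [s] stands for the Bradley-Terry policy at one prompt, described by its support and its pairwise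
    winning probabilities. *)
Variable s : distr R Y.
Hypothesis s_support : same_support m s.
Hypothesis s_share : forall y z, m y != 0 -> m z != 0 -> share s y z = p y z.

Lemma score0_bt y : score 0 m p s y = 0.
Proof.
rewrite /score mul0r add0r; have [->|my] := eqVneq (m y) 0.
  by rewrite mulr0 mul0r.
rewrite big1 ?mulr0// => z _; have [->|mz] := eqVneq (m z) 0.
  by rewrite mul0r.
by rewrite s_share// subrr mulr0.
Qed.

(** Scores are compared at parameter 0, where that of [s] vanishes and that of [q] is
    [- l * (q y - m y)], of size at most [l]. *)
Lemma argmin_near_bt (l : R) q : 0 < l -> prompt_argmin l m p q ->
  forall y, `|q y - s y| <= stab_const m s * l.
Proof.
move=> l0 amin; apply: (@score_stability _ _ m p q s 0) => //.
  exact: argmin_same_support amin.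
move=> y; rewrite score0_bt subr0 (score_shift m p q l).
rewrite (argmin_score p01 pC l0 amin) add0r sub0r normrM normrN.
by rewrite (gtr0_norm l0) ler_piMr ?(ltW l0)// dist_pmf_le1.
Qed.

(** The score of [s] would vanish at both 0 and [l]; being affine in the parameter, it has slope
    [s y - m y = 0]. *)
Lemma argmin_eq_bt (l : R) q : 0 < l -> prompt_argmin l m p q ->
  q =1 s -> s =1 m.
Proof.
move=> l0 amin qs y; have := argmin_score p01 pC l0 amin y.
have -> : score l m p q y = score l m p s y.
  rewrite /score /share qs; congr (_ + _ * _).
  by apply: eq_bigr => z _; rewrite qs.
rewrite (score_shift m p s 0) score0_bt add0r subr0 => /eqP.
by rewrite mulf_eq0 gt_eqF//= subr_eq0 => /eqP.
Qed.

(** For [q = m] the penalty term is zero, so [q] has zero score at parameter 0 as well, like [s];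
    stability with [eps = 0] identifies the two. *)
Lemma argmin_eq_ref (l : R) q : 0 < l -> prompt_argmin l m p q ->
  q =1 m -> s =1 m.
Proof.
move=> l0 amin qm y.
have mscore z : score 0 m p q z = 0.
  rewrite (score_shift m p q l) (argmin_score p01 pC l0 amin).
  by rewrite qm subrr mulr0 addr0.
have := @score_stability _ _ m p q s 0 0 (lexx 0)
  (argmin_same_support l0 amin) s_support.
move=> /(_ _ y); rewrite mulr0 normr_le0 subr_eq0 qm => /(_ _)/eqP/esym.
by apply => z; rewrite mscore score0_bt subrr normr0.
Qed.

End PromptLimits.

(** * From explicit bounds to limits *)

Section Convergence.
Context {R : realType}.

Lemma cvg_at0_linear_bound (f : R -> R) (L C : R) :
  (forall l, 0 < l -> `|f l - L| <= C * l) ->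
  f l @[l --> 0^'+] --> L.
Proof.
move=> fL; apply/cvgrPdistC_le => e e0.
(* [C] may be zero or negative; this larger constant can be divided by. *)
have C0 : 0 < `|C| + 1 by rewrite ltr_wpDl.
near=> l; have l0 : 0 < l by near: l; exact: nbhs_right_gt.
apply: le_trans (fL _ l0) _.
apply: (@le_trans _ _ ((`|C| + 1) * l)).
  by rewrite ler_wpM2r ?(ltW l0)// (le_trans (ler_norm _))// lerDl.
rewrite mulrC -ler_pdivlMr//; near: l; apply: nbhs_right_le.
by rewrite divr_gt0.
Unshelve. all: by end_near. Qed.

Lemma cvg_lipschitz_bound (f : R -> R) (l0 C : R) : 0 < l0 ->
  (forall l, 0 < l -> `|f l - f l0| <= C * `|l - l0|) ->
  f l @[l --> l0] --> f l0.
Proof.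
move=> l0_gt0 fL; apply/cvgrPdistC_le => e e0.
have C0 : 0 < `|C| + 1 by rewrite ltr_wpDl.
near=> l; have l_gt0 : 0 < l by near: l; exact: lt_nbhsr.
apply: le_trans (fL _ l_gt0) _.
apply: (@le_trans _ _ ((`|C| + 1) * `|l - l0|)).
  by rewrite ler_wpM2r// (le_trans (ler_norm _))// lerDl.
rewrite mulrC -ler_pdivlMr// distrC; near: l.
by apply: cvgr_dist_le; [exact: cvg_id | rewrite divr_gt0].
Unshelve. all: by end_near. Qed.

Lemma cvg_pinfty_inv_bound (f : R -> R) (L C : R) : 0 < C ->
  (forall l, 0 < l -> `|f l - L| <= C / l) ->
  f l @[l --> +oo] --> L.
Proof.
move=> C0 fL; apply/cvgrPdistC_le => e e0.
near=> l; have l0 : 0 < l by near: l; exact: nbhs_pinfty_gt.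
apply: le_trans (fL _ l0) _.
rewrite ler_pdivrMr// mulrC -ler_pdivrMr//; near: l.
Unshelve. all: by end_near. Qed.

End Convergence.

(** * Bradley-Terry preferences and the associated optimal policy *)

Section BradleyTerry.
Context {R : realType} {X Y : finType}.
Variables (r : Y -> X -> R) (pstar : X -> Y -> Y -> R) (piref : policy R X Y).
Hypothesis pstar_bt : bradley_terry r pstar.

Lemma pstar01 x y z : 0 < pstar x y z < 1.
Proof.
have ey := expR_gt0 (r y x); have ez := expR_gt0 (r z x).
rewrite pstar_bt divr_gt0 ?addr_gt0//=.
by rewrite ltr_pdivrMr ?addr_gt0// mul1r ltrDl.
Qed.

Lemma pstarC x y z : pstar x y z + pstar x z y = 1.
Proof.
rewrite !pstar_bt [X in _ + _ / X]addrC -mulrDl divff// gt_eqF//.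
by rewrite addr_gt0 ?expR_gt0.
Qed.

Let weight x := \sum_(y' | 0 < piref x y') expR (r y' x).

Lemma piref_gt0 x y : (0 < piref x y) = (piref x y != 0).
Proof. by rewrite lt_def Defs.pmf_ge0 andbT. Qed.

Lemma bt_pmfE x y : piref x y != 0 ->
  bt_policy r piref x y = expR (r y x) / weight x.
Proof. by move=> my; rewrite /= /bt_pmf piref_gt0 my. Qed.

Lemma bt_weight_gt0 x : 0 < weight x.
Proof.
have [y my] := distr_exists_neq0 (piref x).
rewrite /weight (bigD1 y) ?piref_gt0//= ltr_pwDl ?expR_gt0//.
by rewrite sumr_ge0// => z _; exact: expR_ge0.
Qed.

Lemma bt_same_support x : same_support (piref x) (bt_policy r piref x).
Proof.
move=> y; have [my|my] := eqVneq (piref x y) 0.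
  by rewrite /= /bt_pmf my ltxx eqxx.
by rewrite bt_pmfE// gt_eqF// divr_gt0 ?expR_gt0 ?bt_weight_gt0.
Qed.

Lemma bt_share x y z : piref x y != 0 -> piref x z != 0 ->
  share (bt_policy r piref x) y z = pstar x y z.
Proof.
move=> my mz; rewrite /share !bt_pmfE// pstar_bt -mulrDl -mulf_div divff ?mulr1//.
by rewrite gt_eqF// invr_gt0 bt_weight_gt0.
Qed.

End BradleyTerry.

Theorem proposition4 (R : realType) (X Y : finType) (D : distr R X)
    (piref : policy R X Y) (r : Y -> X -> R) (pstar : X -> Y -> Y -> R)
    (pstar_bt : bradley_terry r pstar) :
  SIC D (bt_policy r piref) piref (ell_typo D pstar).
Proof.
have p01 := pstar01 pstar_bt; have pC := pstarC pstar_bt.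
have D_neq0 x : 0 < D x -> D x != 0 by move=> /gt_eqF ->.
have amin l pi x : 0 < l -> 0 < D x ->
    is_argmin (fun pi => ell_typo D pstar pi piref l) pi ->
    prompt_argmin l (piref x) (pstar x) (pi x).
  by move=> l0 Dx /(is_argminP _ _ _ l0); apply; exact: D_neq0.
have supp := bt_same_support r piref.
have shr x := @bt_share _ _ _ _ _ piref pstar_bt x.
split.
- move=> l l0.
  have [pi piP] := choice (fun x =>
    prompt_argmin_exists (piref x) (p01 x) l0).
  by exists pi; apply/(is_argminP _ _ _ l0) => x _; exact: piP.
- move=> l pi1 pi2 l0 min1 min2 x Dx y; apply/eqP.
  (* At equal parameters the Lipschitz bound is zero, which gives uniqueness. *)
  have := argmin_lipschitz (p01 x) (pC x) l0 l0 (amin _ _ _ l0 Dx min1)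
    (amin _ _ _ l0 Dx min2) y.
  by rewrite subrr normr0 mulr0 normr_le0 subr_eq0.
- move=> sel selP x y Dx; apply: cvg_at0_linear_bound => l l0.
  exact: (argmin_near_bt (p01 x) (pC x) (supp x) (@shr x) l0
    (amin _ _ _ l0 Dx (selP _ l0))).
- move=> sel selP x y Dx; apply: (@cvg_pinfty_inv_bound _ _ _ 2) => // l l0.
  exact: (argmin_near_ref (p01 x) (pC x) l0 (amin _ _ _ l0 Dx (selP _ l0))).
- move=> sel selP x y Dx l0 l0_gt0.
  apply: (@cvg_lipschitz_bound _ (fun l => sel l x y)) => // l l_gt0.
  exact: (argmin_lipschitz (p01 x) (pC x) l_gt0 l0_gt0
    (amin _ _ _ l_gt0 Dx (selP _ l_gt0)) (amin _ _ _ l0_gt0 Dx (selP _ l0_gt0))).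
- move=> l pi l0 pimin x Dx neq; have pix := amin _ _ _ l0 Dx pimin.
  split=> eqpi; apply: neq.
    exact: (argmin_eq_bt (p01 x) (pC x) (@shr x) l0 pix).
  exact: (argmin_eq_ref (p01 x) (pC x) (supp x) (@shr x) l0 pix).
Qed.
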